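(* For a tree $T$ of order $n$, $vcfc(T)\leq vcfc(P_n)$, where $P_n$ is the path on $n$ vertices.
   Context: Graphs are finite, simple and undirected. A path in a vertex-colored graph is called conflict-free if there is a color used on exactly one of its vertices. A vertex-colored graph is conflict-free vertex-connected if any two vertices of the graph are connected by a conflict-free path. The conflict-free vertex-connection number $vcfc(G)$ of a connected graph $G$ is the smallest number of colors required in a vertex-coloring of $G$ that makes $G$ conflict-free vertex-connected. *)

(* Defs.v *)
From mathcomp Require Import all_boot.
From mathcomp Require Import boolp.

Set Implicit Arguments.
Unset Strict Implicit.
Unset Printing Implicit Defensive.

Record sgraph := SGraph {
  vertex :> finType;
  adj : rel vertex;
  adj_sym : symmetric adj;
  adj_irrefl : irreflexive adj }.

Definition connected (G : sgraph) : Prop :=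
  0 < #|G| /\ forall x y : G, connect (@adj G) x y.

(* The bound on the size excludes the degenerate "cycles" [::] and [:: x; y]
   with x, y adjacent, which satisfy ucycle. *)
Definition acyclic (G : sgraph) : Prop :=
  forall c : seq G, ucycle (@adj G) c -> size c < 3.

Definition tree (G : sgraph) : Prop := connected G /\ acyclic G.

(* x :: p is the vertex sequence of a path (without repeated vertices)
   from x to y. *)
Definition upath (G : sgraph) (x y : G) (p : seq G) : Prop :=
  [/\ path (@adj G) x p, last x p = y & uniq (x :: p)].

Definition conflict_free (G : sgraph) (C : eqType) (f : G -> C) (s : seq G)
  : Prop := exists c : C, count (fun v => f v == c) s = 1.

Definition cf_vertex_connected (G : sgraph) (C : eqType) (f : G -> C) : Prop :=
  forall x y : G, x != y ->
    exists p : seq G, upath x y p /\ conflict_free f (x :: p).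

(* The colouring need not be proper. *)
Definition cf_colorable (G : sgraph) (k : nat) : Prop :=
  exists f : G -> 'I_k, cf_vertex_connected f.

Lemma cf_colorable_ex_bool (G : sgraph) :
  (exists k, cf_colorable G k) -> exists k, `[< cf_colorable G k >].
Proof. by case=> k Gk; exists k; apply/asboolP. Qed.

(* The least k with cf_colorable G k; the value 0 is taken only when there is
   no such k, which does not happen for a connected G (see vcfcP). *)
Definition vcfc (G : sgraph) : nat :=
  if pselect (exists k, cf_colorable G k) is left exk
  then ex_minn (cf_colorable_ex_bool exk) else 0.

Definition path_adj (n : nat) : rel 'I_n :=
  fun i j => (i.+1 == j) || (j.+1 == i).

Lemma path_adj_sym n : symmetric (@path_adj n).
Proof. by move=> i j; rewrite /path_adj orbC. Qed.

Lemma path_adj_irrefl n : irreflexive (@path_adj n).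
Proof. by move=> i; rewrite /path_adj orbb eqn_leq ltnn. Qed.

Definition path_graph (n : nat) : sgraph :=
  SGraph (@path_adj_sym n) (@path_adj_irrefl n).

Lemma connected_cf_colorable (G : sgraph) :
  connected G -> cf_colorable G (#|G|).
Proof.
case=> _ conG; exists (@enum_rank G) => x y _.
have /connectP[q qP ->] := conG x y.
case: (shortenP qP) => p pP up _; exists p; split; first by split.
exists (enum_rank x); rewrite (eq_count (a2 := pred1 x)).
  by rewrite count_uniq_mem // mem_head.
by move=> v /=; rewrite (inj_eq enum_rank_inj).
Qed.

Lemma vcfcP (G : sgraph) : connected G ->
  cf_colorable G (vcfc G) /\ forall k, cf_colorable G k -> vcfc G <= k.
Proof.
move=> conG; rewrite /vcfc; case: pselect => [exk|[]]; last first.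
  by exists (#|G|); apply: connected_cf_colorable.
case: ex_minnP => m /asboolP Gm minm; split=> // k Gk.
by apply: minm; apply/asboolP.
Qed.

Lemma path_graph_connected (n : nat) : 0 < n -> connected (path_graph n).
Proof.
case: n => // n _; split; first by rewrite card_ord.
have sym : connect_sym (@adj (path_graph n.+1)).
  exact/sym_connect_sym/adj_sym.
have from0 (k : nat) (lt_kn : k < n.+1) :
    connect (@adj (path_graph n.+1)) ord0 (Ordinal lt_kn).
  elim: k lt_kn => [|k IHk] lt_kn.
    by rewrite (_ : Ordinal _ = ord0) ?connect0 //; apply: val_inj.
  apply: connect_trans (IHk (ltnW lt_kn)) (connect1 _).
  by rewrite /= /path_adj /= eqxx.
move=> [i lt_in] [j lt_jn]; apply: connect_trans (from0 _ lt_jn).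
by rewrite sym.
Qed.

(* Main.v *)
(* If P_n has a conflict-free colouring with k colours, then the n + 1 vectors
   of parities of the colour counts on the initial segments of P_n are pairwise
   distinct, since two equal ones would bound a segment on which every colour
   occurs an even number of times; hence n + 1 <= 2 ^ k. Conversely, a forest
   with fewer than 2 ^ k vertices has a colouring with k colours in which every
   path is conflict-free: give one colour to a centroid alone, and recurse on
   the components left by its removal, which have fewer than 2 ^ (k - 1)
   vertices. *)
Require Import Defs.
From mathcomp Require Import all_boot.
From mathcomp Require Import zify.

Set Implicit Arguments.
Unset Strict Implicit.
Unset Printing Implicit Defensive.

(** * Lower bound on the colours of a path *)

Lemma conflict_free_segments_ltn_exp (C : finType) (n : nat) (h : nat -> C) :
  (forall i j, i < j -> j <= n ->
     exists c, count (fun m => h m == c) (iota i (j - i)) = 1) ->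
  n < 2 ^ #|C|.
Proof.
move=> cf_h.
(* Counting the empty initial segment gives n + 1 vectors, hence the strict bound. *)
pose par (i : 'I_n.+1) :=
  [ffun c : C => odd (count (fun m => h m == c) (iota 0 i))].
have neq_par (i j : 'I_n.+1) : i < j -> par i != par j.
  move=> ltij; have [c count_c] := cf_h i j ltij (ltn_ord j : j <= n).
  apply/eqP => /ffunP/(_ c); rewrite !ffunE -(subnKC (ltnW ltij)) iotaD.
  by rewrite count_cat count_c oddD; case: odd.
have par_inj : injective par.
  move=> i j eq_ij; apply: val_inj; case: (ltngtP i j) => // /neq_par.
    by rewrite eq_ij eqxx.
  by rewrite eq_ij eqxx.
by have := leq_card par par_inj; rewrite card_ord card_ffun card_bool.
Qed.

(** A path cannot turn back: after a first step from x away from y, the rest would by induction run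
    upwards to y and meet x again. *)
Lemma path_graph_upath_iota (n : nat) (x y : path_graph n) p :
  upath x y p -> x < y ->
  map (@nat_of_ord n) (x :: p) = iota x (y - x).+1.
Proof.
elim: p x => [|z p IHp] x [/= pathP lastP uniqP] lt_xy.
  by rewrite lastP ltnn in lt_xy.
case/andP: pathP => adj_xz path_zp; case/andP: uniqP => x_notin uniq_zp.
have IHz := IHp z (And3 path_zp lastP uniq_zp).
case/orP: adj_xz => /eqP def_z.
  have [lt_zy|le_yz] := ltnP z y.
    have -> : y - x = (y - z).+1 by lia.
    by have /= [->] := IHz lt_zy; rewrite -def_z.
  have eq_zy : z = y by apply: val_inj => /=; lia.
  case: p lastP uniq_zp {IHp IHz path_zp x_notin} => [|w p] /= lastP uniq_zp.
    by rewrite -eq_zy -def_z subSnn.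
  by case/andP: uniq_zp; rewrite eq_zy -lastP mem_last.
have /IHz eq_iota : z < y by lia.
suff /mapP[w w_in /val_inj def_w] : (x : nat) \in map (@nat_of_ord n) (z :: p).
  by rewrite def_w w_in in x_notin.
by rewrite eq_iota mem_iota; lia.
Qed.

Lemma path_graph_cf_colorable_ltn (n k : nat) :
  cf_colorable (path_graph n) k -> n < 2 ^ k.
Proof.
case: n => [|n] [f cf_f]; first by rewrite expn_gt0.
rewrite -[k in 2 ^ k]card_ord.
apply: (@conflict_free_segments_ltn_exp _ _ (fun m => f (inord m))) => i j.
case: j => // j lt_ij lt_jn; rewrite subSn //.
have lt_in : i < n.+1 by apply: leq_trans lt_ij lt_jn.
(* [cf_f] only speaks of distinct vertices; a segment of one vertex is conflict-free anyway. *)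
have [lt_ij'|le_ji] := ltnP i j; last first.
  exists (f (inord i)); have -> : j - i = 0 by lia.
  by rewrite /= eqxx.
pose x : path_graph n.+1 := Ordinal lt_in.
pose y : path_graph n.+1 := Ordinal lt_jn.
have neq_xy : x != y by rewrite -val_eqE /= neq_ltn lt_ij'.
have [p [xyp [c count_c]]] := cf_f x y neq_xy.
exists c; rewrite -[iota _ _](path_graph_upath_iota xyp lt_ij') -count_c.
by rewrite count_map; apply: eq_count => v /=; rewrite inord_val.
Qed.

(** * Components and centroids in a forest *)

(** The subgraph induced by [A], kept as a relation on [G] so that the recursion never changes the
    graph. *)
Definition adj_in (G : sgraph) (A : {set G}) : rel G :=
  [rel x y | [&& adj x y, x \in A & y \in A]].

Definition component (G : sgraph) (A : {set G}) (x : G) : {set G} :=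
  [set y | connect (adj_in A) x y].

Lemma connect_adj_in_sym (G : sgraph) (A : {set G}) : connect_sym (adj_in A).
Proof.
apply: sym_connect_sym => x y; rewrite /adj_in /= adj_sym.
by congr (_ && _); rewrite andbC.
Qed.

Lemma component_closed (G : sgraph) (A : {set G}) x :
  closed (adj_in A) (component A x).
Proof.
move=> y z yz; rewrite !inE.
exact: (same_connect_r (connect_adj_in_sym A) (connect1 yz)).
Qed.

Lemma component_sub (G : sgraph) (A : {set G}) x :
  x \in A -> component A x \subset A.
Proof.
move=> xA; apply/subsetP => y; rewrite inE => xy.
suff closedA : closed (adj_in A) A by rewrite -(closed_connect closedA xy).
by move=> a b /and3P[_ -> ->].
Qed.

Lemma path_adj_in (G : sgraph) (A : {set G}) x p :
  path (@adj G) x p -> {subset x :: p <= A} -> path (adj_in A) x p.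
Proof.
elim: p x => //= y p IHp x /andP[xy py] sub.
have sub' : {subset y :: p <= A}.
  by move=> z z_in; apply: sub; rewrite inE z_in orbT.
by rewrite IHp // /adj_in /= xy sub ?mem_head // sub' ?mem_head.
Qed.

Lemma path_sub_component (G : sgraph) (A : {set G}) x p z :
  path (@adj G) x p -> {subset x :: p <= A} -> z \in x :: p ->
  component A z = component A x.
Proof.
move=> xp sub z_in; apply/setP => y; rewrite !inE.
apply: (same_connect (connect_adj_in_sym A)); rewrite connect_adj_in_sym.
exact: (path_connect (path_adj_in xp sub)).
Qed.

(** A simple path in [A] from w to w' closes up through v; unless it is trivial, this gives a cycle
    on at least three vertices. *)
Lemma acyclic_component_adj_unique (G : sgraph) (A : {set G}) v x w w' :
  acyclic G -> x \in A -> v \notin A ->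
  w \in component A x -> w' \in component A x ->
  adj v w -> adj v w' -> w' = w.
Proof.
move=> acG xA vA wD w'D vw vw'.
have wA : w \in A := subsetP (component_sub xA) w wD.
have: connect (adj_in A) w w'.
  rewrite !inE in wD w'D; rewrite connect_adj_in_sym in wD.
  exact: connect_trans wD w'D.
case/connectP=> q0 /shortenP[q qP uq _] def_w'; rewrite {w'D}def_w' in vw' *.
have qA : {subset q <= A}.
  move=> z zq; apply: (subsetP (component_sub wA)); rewrite inE.
  by apply: (path_connect qP); rewrite inE zq orbT.
have cyc : ucycle (@adj G) [:: v, w & q].
  rewrite /ucycle /= rcons_path vw /= (adj_sym (last w q)) vw' andbT.
  rewrite (sub_path _ qP) //=; last by move=> a b /and3P[].
  move: uq => /= ->; rewrite andbT inE negb_or.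
  by apply/andP; split; apply: contraNN vA; [move/eqP-> | move/qA].
by case: q qP uq vw' qA cyc => // a q _ _ _ _ /acG.
Qed.

(** Choose v so that the largest component left is smallest; were its size at least m, moving from v
    into that component would make the maximum drop. *)
Lemma acyclic_centroid (G : sgraph) (A : {set G}) (m : nat) :
  acyclic G -> 0 < #|A| -> #|A| < m.*2 ->
  exists2 v, v \in A &
    forall u, u \in A :\ v -> #|component (A :\ v) u| < m.
Proof.
move=> acG /card_gt0P[v0 v0A] ltAm.
pose M v := \max_(u in A :\ v) #|component (A :\ v) u|.
case: (arg_minnP M v0A) => v vA min_v; exists v => // u uA.
rewrite ltnNge; apply/negP => le_m.
have leM : m <= M v by apply: leq_trans le_m (leq_bigmax_cond _ uA).
have [|x xA eqM] :=
  @eq_bigmax_cond _ (mem (A :\ v)) (fun u => #|component (A :\ v) u|).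
  by apply/card_gt0P; exists u.
rewrite -/(M v) in eqM.
set D := component (A :\ v) x in eqM.
have vNA : v \notin A :\ v by rewrite !inE eqxx.
have DA : D \subset A :\ v := component_sub xA.
have [w wD w_uniq] : exists2 w, w \in D & {in D, forall w', adj v w' -> w' = w}.
  case: (pickP [pred w in D | adj v w]) => [w /andP[/= wD vw]|noadj].
    exists w => // w' w'D vw'.
    exact: (acyclic_component_adj_unique acG xA vNA wD w'D vw vw').
  (* If v has no neighbour in [D], any vertex of [D] serves as w. *)
  exists x => [|w' w'D vw']; first by rewrite inE connect0.
  by have := noadj w'; rewrite /= w'D vw'.
(* As w is the only neighbour of v in D, removing w also separates D from v,
   so every component left by w is smaller than D. *)
have closedD : closed (adj_in (A :\ w)) D.
  apply: (intro_closed (connect_adj_in_sym _)) => a b /and3P[ab].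
  move=> /setD1P[aw aA] /setD1P[bw bA] aD.
  have av : a != v by have /setD1P[] := subsetP DA a aD.
  have bv : b != v.
    apply: contraNneq aw => eq_bv; apply/eqP/w_uniq => //.
    by rewrite -eq_bv adj_sym.
  rewrite -(@component_closed _ (A :\ v) x a) //.
  by rewrite /adj_in /= ab !inE av aA bv bA.
have wA : w \in A by have /setD1P[] := subsetP DA w wD.
have D_gt0 : 0 < #|D| by apply/card_gt0P; exists w.
suff: M w < M v by rewrite ltnNge min_v.
rewrite eqM -(prednK D_gt0) ltnS; apply/bigmax_leqP => y yA.
rewrite -ltnS prednK //.
have same z : z \in component (A :\ w) y -> (z \in D) = (y \in D).
  by rewrite inE => yz; rewrite (closed_connect closedD yz).
have subA := subsetP (component_sub yA).
have [yD|yND] := boolP (y \in D).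
  apply: proper_card; apply/properP; split.
    by apply/subsetP => z /same; rewrite yD.
  by exists w => //; apply/negP => /subA; rewrite !inE eqxx.
(* Outside [D] fewer than 2m - m vertices of [A] remain, while [D] has at least m. *)
have: #|component (A :\ w) y| <= #|A :\: D|.
  apply: subset_leq_card; apply/subsetP => z zK.
  by rewrite inE (same z zK) yND; have /setD1P[] := subA z zK.
rewrite cardsD (setIidPr (subset_trans DA (subD1set _ _))).
lia.
Qed.

(** * Colouring a forest *)

(** Colours are naturals because for k = 0 a nonempty [G] has no map to ['I_k], even with [A]
    empty. *)
Lemma acyclic_conflict_free_coloring (G : sgraph) (k : nat) (A : {set G}) :
  acyclic G -> #|A| < 2 ^ k ->
  exists2 f : G -> nat, {in A, forall x, f x < k} &
    forall x p, path (@adj G) x p -> uniq (x :: p) -> {subset x :: p <= A} ->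
      exists2 z, z \in x :: p & count (fun u => f u == f z) (x :: p) = 1.
Proof.
move=> acG; elim: k A => [|k IHk] A.
  rewrite ltnS leqn0 cards_eq0 => /eqP->.
  by exists (fun=> 0) => [x|x p _ _ /(_ x (mem_head x p))]; rewrite inE.
have [->|A_neq0] := eqVneq A set0.
  by move=> _; exists (fun=> 0) => [x|x p _ _ /(_ x (mem_head x p))];
    rewrite inE.
rewrite expnS mul2n -card_gt0 in A_neq0 * => ltA.
have [v vA small] := acyclic_centroid acG A_neq0 ltA.
(* One colouring is fixed for each set, so that all vertices of a component use the same one; for
   large sets any function does. *)
have /fin_all_exists[F FP] (K : {set G}) : exists f : G -> nat, #|K| < 2 ^ k ->
    {in K, forall x, f x < k} /\
    forall x p, path (@adj G) x p -> uniq (x :: p) -> {subset x :: p <= K} ->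
      exists2 z, z \in x :: p & count (fun u => f u == f z) (x :: p) = 1.
  have [/IHk[f f1 f2]|_] := ltnP #|K| (2 ^ k); last by exists (fun=> 0).
  by exists f.
pose f u := if u == v then k else F (component (A :\ v) u) u.
have f_lt u : u \in A :\ v -> f u < k.
  move=> uA; have /setD1P[/negPf neq_uv _] := uA; rewrite /f neq_uv.
  by have [ltF _] := FP _ (small u uA); apply: ltF; rewrite inE connect0.
exists f => [x xA|x p xp uxp sub].
  have [eq_xv|neq_xv] := eqVneq x v; first by rewrite /f eq_xv eqxx.
  by apply: leqW; apply: f_lt; rewrite !inE neq_xv.
(* A path through v has colour k exactly once; any other stays in one component. *)
have [v_in|v_notin] := boolP (v \in x :: p).
  exists v => //; rewrite -[RHS]/(true : nat) -v_in -count_uniq_mem //.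
  apply: eq_in_count => u u_in; rewrite /f eqxx /=.
  have [_|neq_uv] := eqVneq u v; first by rewrite eqxx.
  have := f_lt u; rewrite /f (negPf neq_uv) !inE neq_uv sub // => /(_ isT).
  by rewrite ltn_neqAle => /andP[/negPf].
have sub' : {subset x :: p <= A :\ v}.
  move=> z z_in; rewrite !inE sub // andbT.
  by apply: contraNneq v_notin => <-.
have xA : x \in A :\ v by apply: sub'; rewrite mem_head.
have fE : {in x :: p, forall u, f u = F (component (A :\ v) x) u}.
  move=> u u_in; have /setD1P[/negPf neq_uv _] := sub' u u_in.
  by rewrite /f neq_uv (path_sub_component xp sub' u_in).
have [_ cfF] := FP _ (small x xA).
have [|z z_in count_z] := cfF x p xp uxp.
  by move=> z z_in; rewrite -(path_sub_component xp sub' z_in) inE connect0.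
exists z => //; rewrite -count_z; apply: eq_in_count => u u_in.
by rewrite !fE.
Qed.

Lemma tree_cf_colorable (T : sgraph) (k : nat) :
  tree T -> #|T| < 2 ^ k -> cf_colorable T k.
Proof.
case=> [[_ conT] acT] ltT.
have [|f f_lt cf_f] := @acyclic_conflict_free_coloring T k [set: T] acT.
  by rewrite cardsT.
exists (fun x => Ordinal (f_lt x (in_setT x))) => x y _.
have /connectP[q qP ->] := conT x y.
case: (shortenP qP) => p pP up _; exists p; split; first by split.
have [|z _ count_z] := cf_f x p pP up; first by move=> z _; rewrite inE.
exists (Ordinal (f_lt z (in_setT z))).
by rewrite -count_z; apply: eq_count.
Qed.

Theorem theorem2p2 (T : sgraph) (n : nat) (treeT : tree T)
    (orderT : #|T| = n) :
  vcfc T <= vcfc (path_graph n).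
Proof.
have [conT _] := treeT; have [_ vcfc_min] := vcfcP conT.
(* The two halves meet at n < 2 ^ k, with k the number for the path. *)
apply: vcfc_min; apply: tree_cf_colorable => //; rewrite orderT.
apply: path_graph_cf_colorable_ltn.
by apply: (vcfcP _).1; apply: path_graph_connected; rewrite -orderT; case: conT.
Qed.
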